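(* Let $\Gamma$ be a metrized graph with vertex set $V(\Gamma)$ and edge set $E(\Gamma)$, with resistance function $r(x,y)$, canonical measure $\mu_{can}$, tau constant $\tau(\Gamma)$ and Arakelov-Green function $g_{\mu_{can}}(x,y)$. Suppose $e_i \in E(\Gamma)$ is an edge of length $L_i$ with end points $p_i$ and $q_i$, and $e_j \in E(\Gamma)$ is an edge of length $L_j$ with end points $p_j$ and $q_j$. Let $x$ and $y$ belong to $e_i$ and $e_j$, respectively. (On the right-hand sides below, $x$ and $y$ denote the real parameters of the corresponding points.) (1) If both $x$ and $y$ are on the same edge and that edge is a bridge, then $$g_{\mu_{can}}(x,y)= \tau(\Gamma)- \frac{1}{2}|x-y|.$$ (2) If $e_i$ and $e_j$ are both bridges and are distinct edges, then $$g_{\mu_{can}}(x,y)=\begin{cases} \tau(\Gamma) -\frac{1}{2}\big(x+y+r(p_i,p_j)\big), & \text{if } p_i \text{ and } p_j \text{ are between } x \text{ and } y, \\ \tau(\Gamma)- \frac{1}{2}\big(x+L_j-y+r(p_i,q_j) \big), & \text{if } p_i \text{ and } q_j \text{ are between } x \text{ and } y,\\ \tau(\Gamma)- \frac{1}{2}\big(L_i-x+y+r(p_j,q_i)\big), & \text{if } p_j \text{ and } q_i \text{ are between } x \text{ and } y,\\ \tau(\Gamma)- \frac{1}{2}\big(L_i-x+L_j-y+r(q_i,q_j)\big), & \text{if } q_i \text{ and } q_j \text{ are between } x \text{ and } y. \end{cases}$$ (3) Suppose only $e_i$ is a bridge, i.e. $e_i$ is a bridge and $e_j$ is not (the case in which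 only $e_j$ is a bridge is the same after exchanging roles). If $y$ is on the side of $p_i$, then $$g_{\mu_{can}}(x,y) =\tau(\Gamma)+y^2\, \frac{L_j - r(p_j,q_j)}{2L_j^2}-y\, \frac{L_j-r(p_j,q_j)+r(p_i,q_j)-r(p_i,p_j)}{2L_j} -\frac{1}{2}\big(x +r(p_i,p_j) \big).$$ If $y$ is on the side of $q_i$, then $$g_{\mu_{can}}(x,y) =\tau(\Gamma) +y^2\, \frac{L_j - r(p_j,q_j)}{2L_j^2}-y\, \frac{L_j-r(p_j,q_j)+r(q_i,q_j)-r(q_i,p_j)}{2L_j} -\frac{1}{2}\big(L_i-x +r(q_i,p_j) \big).$$
   Context: A metrized graph $\Gamma$ is a finite connected graph whose edges are equipped with a distinguished parametrization by line segments (multiple edges and self-loops are allowed). The valence of $p\in\Gamma$ is the number of directions emanating from $p$. A vertex set $V(\Gamma)$ is a finite non-empty subset of $\Gamma$ containing every point of valence $\neq 2$ (additional points of valence 2 may be included). The set $E(\Gamma)$ of edges is the set of closed line segments with end points in $V(\Gamma)$ into which $V(\Gamma)$ divides $\Gamma$; the length of $e_i$ is a positive real number $L_i$. An edge $e_i$ is a bridge if $\Gamma-e_i$, the graph obtained by deleting the interior of $e_i$, is disconnected. Sides: if $e_i$ is a bridge, then $\Gamma-e_i$ has two components, one containing $p_i$ and one containing $q_i$; a point is ''on the side of $p_i$'' (resp. ''of $q_i$'') if it lies in the component of $\Gamma-e_i$ containing $p_i$ (resp. $q_i$). If $e_i\ne e_j$ are both bridges, and $a\in\{p_i,q_i\}$,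 $b\in\{p_j,q_j\}$, then ''$a$ and $b$ are between $x$ and $y$'' (for $x\in e_i$, $y\in e_j$) means that $e_j$ lies in the component of $\Gamma-e_i$ containing $a$ and $e_i$ lies in the component of $\Gamma-e_j$ containing $b$. Parametrization convention: an edge $e_i$ of length $L_i$ with end points $p_i,q_i$ is identified with $[0,L_i]$ so that $p_i$ corresponds to $0$ and $q_i$ to $L_i$ (likewise for $e_j$). A point of an edge and the corresponding real number are denoted by the same letter: in the arguments of $r$ and $g_{\mu_{can}}$ the letters denote points of $\Gamma$, elsewhere in formulas they denote the real parameters. Voltage and resistance functions: view $\Gamma$ as a resistive electric circuit in which each edge has resistance equal to its length. For $x,y,z\in\Gamma$, $j_z(x,y)$ is the voltage difference between $x$ and $z$ when unit current enters at $y$ and exits at $z$ (with reference voltage $0$ at $z$). Equivalently, for fixed $y,z$, $x\mapsto j_z(x,y)$ is the unique continuous piecewise affine function $f$ on $\Gamma$ with $f(z)=0$ and $\Delta f=\delta_y-\delta_z$, where $\Delta f=-\sum_{p}\sigma_p(f)\,\delta_p$ and $\sigma_p(f)$ is the sum of the slopes of $f$ in all directions emanating from $p$. The resistance function is $r(x,y)=j_y(x,x)$, the effective resistance between $x$ and $y$. Canonical measure, tau constant, Arakelov-Green function: for a real-valued signed Borel measure $\mu$ on $\Gamma$ with $\mu(\Gamma)=1$ and $|\mu|(\Gamma)<\infty$, put $j_\mu(x,y)=\int_\Gamma j_z(x,y)\,d\mu(z)$. There is a unique such measure $\mu=\mu_{can}$ for which $j_\mu(x,x)$ is constant on $\Gamma$;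 it is called the canonical measure. The tau constant is $\tau(\Gamma)=\frac12 j_{\mu_{can}}(x,x)$ (for any $x\in\Gamma$). The Arakelov-Green function associated to $\mu$ is $$g_\mu(x,y)=\int_\Gamma j_z(x,y)\,d\mu(z)-\int_{\Gamma^3} j_z(x,y)\,d\mu(z)\,d\mu(x)\,d\mu(y).$$ *)

(* Defs.v *)
From HB Require Import structures.
From mathcomp Require Import all_boot all_order all_algebra.
From mathcomp Require Import all_classical all_reals all_analysis.

Set Implicit Arguments.
Unset Strict Implicit.
Unset Printing Implicit Defensive.

Import Order.TTheory GRing.Theory Num.Theory.
Import numFieldNormedType.Exports.

Local Open Scope classical_set_scope.
Local Open Scope ring_scope.

(* Adjacency in the multigraph with vertex set V and edge set A; the edge e
   joins src e to tgt e.  Loops and multiple edges are allowed. *)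
Definition graph_adj (V E : finType) (src tgt : E -> V) (A : pred E) : rel V :=
  fun u v => [exists e in A, ((src e == u) && (tgt e == v))
                          || ((src e == v) && (tgt e == u))].

(* A metrized graph with a chosen vertex set and, for every edge e, a
   parametrization by [0, elen e] in which src e (the end point p) corresponds
   to 0 and tgt e (the end point q) to elen e.  Vertices of valence 2 are
   allowed. *)
Record metrized_graph (R : realType) := MetrizedGraph {
  vert : finType ;
  edge : finType ;
  src : edge -> vert ;
  tgt : edge -> vert ;
  elen : edge -> R ;
  elen_gt0 : forall e, 0 < elen e ;
  vert_gt0 : (0 < #|vert|)%N ;
  graph_connected : forall u v, connect (graph_adj src tgt predT) u v
}.

(* The points of Gamma: the vertices, and the pairs (e, t) with 0 < t < elen e
   for the interior points of the edges. *)
Definition gpoint (R : realType) (G : metrized_graph R) : Type :=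
  (vert G + {z : edge G * R | (0 < z.2) && (z.2 < elen z.1)})%type.

HB.instance Definition _ (R : realType) (G : metrized_graph R) :=
  Choice.on (gpoint G).

Definition vpt (R : realType) (G : metrized_graph R) (v : vert G) : gpoint G :=
  inl v.

HB.instance Definition _ (R : realType) (G : metrized_graph R) :=
  isPointed.Build (gpoint G) (vpt (enum_val (Ordinal (vert_gt0 G)))).

(* The point of the edge e with parameter t; parameters outside [0, elen e]
   are clamped to that interval. *)
Definition ept (R : realType) (G : metrized_graph R) (e : edge G) (t : R) :
    gpoint G :=
  match insub (e, t) with
  | Some z => inr z
  | None => if t <= 0 then inl (src e) else inl (tgt e)
  end.

(* The topology of Gamma, glued from the segments [0, elen e].  Since ept e
   factors through the retraction of R onto [0, elen e], the preimage of U in R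
   is open iff its trace on [0, elen e] is relatively open. *)
Definition gopen (R : realType) (G : metrized_graph R) : set_system (gpoint G) :=
  [set U | forall e : edge G, open (ept e @^-1` U)].

Lemma gopenT (R : realType) (G : metrized_graph R) : @gopen R G setT.
Proof. by move=> e; rewrite preimage_setT; exact: openT. Qed.

Lemma gopenI (R : realType) (G : metrized_graph R) (A B : set (gpoint G)) :
  gopen A -> gopen B -> gopen (A `&` B).
Proof. by move=> oA oB e; rewrite preimage_setI; exact: openI. Qed.

Lemma gopen_bigU (R : realType) (G : metrized_graph R) (I : Type)
    (f : I -> set (gpoint G)) :
  (forall i, gopen (f i)) -> gopen (\bigcup_i f i).
Proof.
by move=> of_ e; rewrite preimage_bigcup; apply: bigcup_open => i _; exact: of_.
Qed.

HB.instance Definition _ (R : realType) (G : metrized_graph R) :=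
  @isOpenTopological.Build (gpoint G) (@gopen R G)
    (@gopenT R G) (@gopenI R G) (@gopen_bigU R G).

(* Signed Borel measures on Gamma are the charges on gborel G: they take finite
   values, hence have finite total variation. *)
Definition gborel (R : realType) (G : metrized_graph R) :=
  g_sigma_algebraType (@open (gpoint G)).

(* Deletion of the interior of the edge e. *)
Definition connected_without (R : realType) (G : metrized_graph R)
    (e : edge G) : rel (vert G) :=
  connect (graph_adj (@src R G) (@tgt R G) (predC1 e)).

Definition is_bridge (R : realType) (G : metrized_graph R) (e : edge G) : Prop :=
  ~ (forall u v : vert G, connected_without e u v).

(* The connected component of Gamma - e containing the vertex a, as a set of
   points. *)
Definition component_without (R : realType) (G : metrized_graph R)
    (e : edge G) (a : vert G) : set (gpoint G) :=
  [set p | match p with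
           | inl v => connected_without e a v
           | inr z => ((val z).1 != e) && connected_without e a (src (val z).1)
           end].

Definition edge_set (R : realType) (G : metrized_graph R) (e : edge G) :
    set (gpoint G) :=
  ept e @` `[0, elen e].

(* a and b are between the points of ei and those of ej, where a is an end
   point of ei and b an end point of ej. *)
Definition between (R : realType) (G : metrized_graph R)
    (ei : edge G) (a : vert G) (ej : edge G) (b : vert G) : Prop :=
  edge_set ej `<=` component_without ei a /\
  edge_set ei `<=` component_without ej b.

(* s lists the breakpoints of f on the edge e. *)
Definition piecewise_affine (R : realType) (G : metrized_graph R)
    (f : gpoint G -> R) : Prop :=
  forall e : edge G, exists s : seq R, forall a b : R,
    0 <= a -> b <= elen e -> (forall u, u \in s -> u \notin `]a, b[) ->
    exists m c : R, forall t, t \in `[a, b] -> f (ept e t) = m * t + c.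

(* The slope of f at the point of parameter t of e, in the direction of
   increasing (s = 1) or decreasing (s = -1) parameters. *)
Definition slope (R : realType) (G : metrized_graph R) (f : gpoint G -> R)
    (e : edge G) (t s : R) : R :=
  lim (h^-1 * (f (ept e (t + s * h)) - f (ept e t)) @[h --> 0^'+]).

(* Sum of the slopes in all directions emanating from p; a loop at a vertex
   contributes two directions. *)
Definition slope_sum (R : realType) (G : metrized_graph R) (f : gpoint G -> R)
    (p : gpoint G) : R :=
  match p with
  | inl v => \sum_(e : edge G | src e == v) slope f e 0 1 +
             \sum_(e : edge G | tgt e == v) slope f e (elen e) (-1)
  | inr z => slope f (val z).1 (val z).2 1 + slope f (val z).1 (val z).2 (-1)
  end.

(* For f continuous and piecewise affine, Delta f is a finite sum of point
   masses; laplacian f p is its mass at p. *)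
Definition laplacian (R : realType) (G : metrized_graph R) (f : gpoint G -> R)
    (p : gpoint G) : R := - slope_sum f p.

Definition is_voltage (R : realType) (G : metrized_graph R) (z y : gpoint G)
    (f : gpoint G -> R) : Prop :=
  [/\ continuous f, piecewise_affine f, f z = 0 &
      forall p, laplacian f p = (p == y)%:R - (p == z)%:R].

(* voltage z x y is j_z(x, y). *)
Definition voltage (R : realType) (G : metrized_graph R) (z x y : gpoint G) : R :=
  xget (fun=> 0) [set f : gpoint G -> R | is_voltage z y f] x.

Definition resistance (R : realType) (G : metrized_graph R) (x y : gpoint G) : R :=
  voltage y x x.

(* The integral against a signed measure, through its Jordan decomposition. *)
Definition charge_integral d (T : measurableType d) (R : realType)
    (mu : {charge set T -> \bar R}) (f : T -> R) : R :=
  let PN := projT2 (cid (projT2 (cid (Hahn_decomposition mu)))) in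
  \int[jordan_pos PN]_t f t - \int[jordan_neg PN]_t f t.

Definition voltage_integral (R : realType) (G : metrized_graph R)
    (mu : {charge set (gborel G) -> \bar R}) (x y : gpoint G) : R :=
  charge_integral mu (fun z => voltage z x y).

Definition is_canonical_measure (R : realType) (G : metrized_graph R)
    (mu : {charge set (gborel G) -> \bar R}) : Prop :=
  mu setT = 1%E /\
  exists c : R, forall x : gpoint G, voltage_integral mu x x = c.

(* The tau constant when mu is the canonical measure; the point at which the
   constant function is evaluated is then irrelevant. *)
Definition tau_constant (R : realType) (G : metrized_graph R)
    (mu : {charge set (gborel G) -> \bar R}) : R :=
  2^-1 * voltage_integral mu point point.

(* j is bounded and continuous, so the integral over Gamma^3 is written as an
   iterated one. *)
Definition green (R : realType) (G : metrized_graph R)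
    (mu : {charge set (gborel G) -> \bar R}) (x y : gpoint G) : R :=
  voltage_integral mu x y -
  charge_integral mu (fun y' => charge_integral mu (fun x' =>
    charge_integral mu (fun z => voltage z x' y'))).

(* Main.v *)
(** Polarization j_z(x,y) = (r(x,z) + r(y,z) - r(x,y)) / 2, integrated against
    mu_can, gives g(x,y) = tau - r(x,y) / 2, because r(x,.) has the same mean
    2 tau for every x.  So the density of mu_can is never needed, and the theorem
    becomes a statement on effective resistances: on an edge r(p,.) is an
    explicit quadratic polynomial, and across a bridge r is additive.

    The voltage function is j_z(x,y) = K(x,y) - K(x,z) - K(z,y) + K(z,z) for a
    symmetric kernel K with Delta K(.,y) = delta_y - (a measure independent of
    y).  K is built from a symmetric generalized inverse of the Laplacian of the
    vertices, interpolated affinely along the edges, plus the Green function of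
    each single edge with zero boundary values. *)

Require Import Defs.
From mathcomp Require Import all_boot all_order all_algebra.
From mathcomp Require Import all_classical all_reals all_analysis.
From mathcomp Require Import ring lra.

Set Implicit Arguments.
Unset Strict Implicit.
Unset Printing Implicit Defensive.

Import Order.TTheory GRing.Theory Num.Theory.
Import numFieldNormedType.Exports.

Local Open Scope classical_set_scope.
Local Open Scope ring_scope.

(** * The weighted Laplacian on the vertices and a symmetric generalized inverse of it *)

Section VertexLaplacian.
Variables (R : realType) (G : metrized_graph R).
Implicit Types (u : vert G -> R) (v w : vert G) (e : edge G).

(** Signed incidence of [e] at [v]. On a loop the two terms cancel, so a loop never contributes to
    [vlap]. *)
Definition bdry e v : R := (src e == v)%:R - (tgt e == v)%:R.

Definition vlap u v : R := \sum_e bdry e v * (u (src e) - u (tgt e)) / elen e.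

Lemma sum_pick (T : finType) (x : T) (u : T -> R) :
  \sum_y (x == y)%:R * u y = u x.
Proof.
rewrite (bigD1 x) //= eqxx mul1r big1 ?addr0 // => y yx.
by rewrite eq_sym (negbTE yx) mul0r.
Qed.

Lemma sum_bdry e u : \sum_v bdry e v * u v = u (src e) - u (tgt e).
Proof.
under eq_bigr do rewrite mulrBl.
by rewrite sumrB !sum_pick.
Qed.

Lemma sum_bdry_ones e : \sum_v bdry e v = 0.
Proof.
rewrite -[RHS](subrr 1) -(sum_bdry e (fun=> 1)).
by apply: eq_bigr => v _; rewrite mulr1.
Qed.

Lemma sum_vlap u : \sum_v vlap u v = 0.
Proof.
rewrite exchange_big big1 //= => e _.
by under eq_bigr => v _ do rewrite -mulrA; rewrite -mulr_suml sum_bdry_ones mul0r.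
Qed.

(** Summation by parts: this is the Dirichlet energy, with conductance [1 / elen e] on each edge.
    Its positivity is what identifies the kernel of [vlap]. *)
Lemma vlap_energy u :
  \sum_v vlap u v * u v = \sum_e (u (src e) - u (tgt e)) ^+ 2 / elen e.
Proof.
under eq_bigr do rewrite mulr_suml.
rewrite exchange_big /=; apply: eq_bigr => e _.
rewrite expr2 -mulrA -(sum_bdry e u) mulr_suml; apply: eq_bigr => v _.
by rewrite sum_bdry; ring.
Qed.

Lemma connect_const (A : pred (edge G)) (T : eqType) (u : vert G -> T) a b :
  (forall e, A e -> u (src e) = u (tgt e)) ->
  connect (graph_adj (@src R G) (@tgt R G) A) a b -> u a = u b.
Proof.
move=> uA /connectP[p + ->]; elim: p a => //= c p IHp a /andP[ac cp].
rewrite -(IHp c) //.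
by case/existsP: ac => e /andP[/uA ue /orP[]/andP[/eqP<- /eqP<-]].
Qed.

(** The energy vanishes, hence so does each of its nonnegative terms. Thus [u] agrees at the two
    ends of every edge, and connectedness of the graph spreads this to all vertices. *)
Lemma vlap_eq0_const u : (forall v, vlap u v = 0) -> forall a b, u a = u b.
Proof.
move=> u0 a b; apply: connect_const (graph_connected a b) => e _.
have /eqP : \sum_e (u (src e) - u (tgt e)) ^+ 2 / elen e = 0.
  by rewrite -vlap_energy big1 // => v _; rewrite u0 mul0r.
rewrite psumr_eq0; last by move=> i _; rewrite divr_ge0 ?sqr_ge0 ?ltW ?elen_gt0.
move=> /allP/(_ e (mem_index_enum _)) /=.
rewrite mulf_eq0 invr_eq0 (gt_eqF (elen_gt0 e)) orbF sqrf_eq0 subr_eq0.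
by move/eqP.
Qed.

Let n := #|vert G|.

Lemma vlap_scale c u v : vlap (fun w => c * u w) v = c * vlap u v.
Proof. by rewrite /vlap mulr_sumr; apply: eq_bigr => e _; ring. Qed.

Lemma vlap_add u u' v : vlap (fun w => u w + u' w) v = vlap u v + vlap u' v.
Proof. by rewrite /vlap -big_split; apply: eq_bigr => e _ /=; ring. Qed.

Lemma vlap_sub u u' v : vlap (fun w => u w - u' w) v = vlap u v - vlap u' v.
Proof. by rewrite /vlap -sumrB; apply: eq_bigr => e _ /=; ring. Qed.

Let shifted_lap : 'M[R]_n := \matrix_(i, j)
  (\sum_e bdry e (enum_val i) * bdry e (enum_val j) / elen e + 1).

Let mul_shifted_lap (x : 'rV[R]_n) j (u := fun v => x 0 (enum_rank v)) :
  (x *m shifted_lap) 0 j = vlap u (enum_val j) + \sum_v u v.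
Proof.
have sumE (F : vert G -> R) : \sum_v F v = \sum_(i < n) F (enum_val i).
  by rewrite (reindex (@enum_val _ predT)) //; exact/onW_bij/enum_val_bij.
rewrite mxE sumE /vlap.
under [in RHS]eq_bigr do rewrite -sum_bdry sumE mulr_sumr mulr_suml.
rewrite exchange_big -big_split; apply: eq_bigr => i _ /=.
rewrite mxE /u enum_valK mulrDr mulr1 mulr_sumr; congr (_ + _).
by apply: eq_bigr => e _; ring.
Qed.

(* [vlap] has the constants as kernel and cokernel, so adding the all-ones
   matrix makes it invertible without destroying its symmetry. *)
Lemma vlap_sym_inverse :
  exists g : vert G -> vert G -> R, (forall a b, g a b = g b a) /\
    forall b v, vlap (g b) v = (b == v)%:R - n%:R^-1.
Proof.
have n0 : n%:R != 0 :> R by rewrite pnatr_eq0 -lt0n vert_gt0.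
(* Summing the hypothesis over all vertices kills [vlap] and counts the total of [u] exactly [n]
   times. *)
have shift u (w : vert G -> R) :
    (forall v, vlap u v + \sum_a u a = w v) -> \sum_a u a = (\sum_v w v) / n%:R.
  move=> uw; apply: (mulIf n0); rewrite divfK //.
  under [RHS]eq_bigr do rewrite -uw.
  by rewrite big_split /= sum_vlap add0r sumr_const mulr_natr.
have unitM : shifted_lap \in unitmx.
  rewrite -row_free_unit; apply: inj_row_free => x x0.
  pose u v := x 0 (enum_rank v).
  have x0' v : vlap u v + \sum_a u a = 0.
    by rewrite -[v]enum_rankK -mul_shifted_lap x0 mxE.
  have su : \sum_a u a = 0 by rewrite (shift _ _ x0') big1 ?mul0r.
  have uc : forall a b, u a = u b.
    by apply: vlap_eq0_const => v; rewrite -[RHS](x0' v) su addr0.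
  apply/rowP => j; rewrite mxE -[j]enum_valK -/(u _).
  apply: (mulIf n0); rewrite mul0r -su mulr_natr -sumr_const.
  by apply: eq_bigr => a _; exact: uc.
have symM : shifted_lap^T = shifted_lap.
  apply/matrixP => i j; rewrite !mxE; congr (_ + _).
  by apply: eq_bigr => e _; rewrite [_ * bdry e (enum_val i)]mulrC.
exists (fun a b => invmx shifted_lap (enum_rank a) (enum_rank b)); split => [a b|b v].
  by rewrite -{1}symM -trmx_inv mxE.
set u := fun w => _.
have ub v' : vlap u v' + \sum_a u a = (b == v')%:R.
  have := mul_shifted_lap (row (enum_rank b) (invmx shifted_lap)) (enum_rank v').
  rewrite -row_mul mulVmx // !mxE enum_rankK (inj_eq enum_rank_inj) => ->.
  by congr (vlap _ _ + _); [apply/funext => w|apply: eq_bigr => w _]; rewrite mxE.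
(* By [shift], each row of the inverse matrix has total [1 / n]; this is the constant subtracted in
   the statement. *)
have := ub v; rewrite (shift _ _ ub).
have := sum_pick b (fun=> 1); under eq_bigr do rewrite mulr1.
by move=> ->; rewrite mul1r => <-; rewrite addrK.
Qed.

End VertexLaplacian.

(** * Points of the graph, affine interpolation, single-edge Green functions and continuity *)

Section Points.
Variables (R : realType) (G : metrized_graph R).
Implicit Types (u : vert G -> R) (t : R) (v w : vert G) (e : edge G) (p q : gpoint G).

Lemma ept_interior e t (te : (0 < t) && (t < elen e)) :
  ept e t = inr (exist (fun z : edge G * R => (0 < z.2) && (z.2 < elen z.1)) (e, t) te).
Proof.
rewrite /ept; case: insubP => [z _ ze|/=]; last by rewrite te.
by congr inr; apply: val_inj.
Qed.

Lemma ept_src e t : t <= 0 -> ept e t = vpt (src e).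
Proof.
by move=> t0; rewrite /ept insubF /= ?t0 // ltNge t0.
Qed.

Lemma ept_tgt e t : elen e <= t -> ept e t = vpt (tgt e).
Proof.
move=> tL; rewrite /ept insubF /= ?[t < _]ltNge ?tL ?andbF //.
by rewrite leNgt (lt_le_trans (elen_gt0 e) tL).
Qed.

Lemma gpoint_case (P : gpoint G -> Prop) :
  (forall v, P (vpt v)) -> (forall e t, (0 < t) && (t < elen e) -> P (ept e t)) ->
  forall p, P p.
Proof.
move=> Pv Pe [v|[[e t] te]]; first exact: Pv.
by have := Pe e t te; rewrite (ept_interior te).
Qed.

Definition interp u p : R :=
  match p with
  | inl v => u v
  | inr z => let: (e, t) := val z in
      (1 - t / elen e) * u (src e) + t / elen e * u (tgt e)
  end.

Lemma interp_ept u e t : 0 <= t <= elen e ->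
  interp u (ept e t) = (1 - t / elen e) * u (src e) + t / elen e * u (tgt e).
Proof.
have L0 : elen e != 0 by rewrite gt_eqF ?elen_gt0.
case/andP; rewrite le_eqVlt => /predU1P[<- _|t0].
  by rewrite ept_src //=; field.
rewrite le_eqVlt => /predU1P[->|tL]; first by rewrite ept_tgt //=; field.
by rewrite ept_interior ?t0.
Qed.

Lemma interp_sub u u' p : interp (fun w => u w - u' w) p = interp u p - interp u' p.
Proof. by case: p => [//|[[e t] te]] /=; ring. Qed.

Lemma interp_cst c p : interp (fun=> c) p = c.
Proof. by case: p => [//|[[e t] te]] /=; ring. Qed.

(** [interp] is a finite linear combination of vertex values, so interpolations in two variables
    commute. The symmetry of the kernel rests on this. *)
Lemma interp_exchange (g : vert G -> vert G -> R) p q :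
  interp (fun a => interp (fun b => g a b) q) p =
  interp (fun b => interp (fun a => g a b) p) q.
Proof. by case: p => [a|[[e t] te]]; case: q => [b|[[e' t'] te']] //=; ring. Qed.

Lemma vlap_interp (g : vert G -> vert G -> R) q v :
  vlap (fun a => interp (fun b => g b a) q) v = interp (fun b => vlap (g b) v) q.
Proof.
case: q => [//|[[e t] te]] /=.
by rewrite vlap_add !vlap_scale.
Qed.

(* Green function of one edge: its Laplacian is the point mass at q minus the
   barycentric masses of q at the two end points of its edge. *)
Definition tent p q : R :=
  match p, q with
  | inr z, inr w =>
      if (val z).1 == (val w).1
      then Num.min (val z).2 (val w).2 - (val z).2 * (val w).2 / elen (val z).1
      else 0
  | _, _ => 0
  end.

Lemma tentC p q : tent p q = tent q p.
Proof.
case: p => [a|[[e t] te]]; case: q => [b|[[e' t'] te']] //=.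
by case: (eqVneq e e') => // <-; rewrite minC [t * t']mulrC.
Qed.

Lemma tent_vpt p v : tent p (vpt v) = 0.
Proof. by case: p. Qed.

Lemma tent_ept e t t' : 0 <= t <= elen e -> 0 <= t' <= elen e ->
  tent (ept e t) (ept e t') = Num.min t t' - t * t' / elen e.
Proof.
have L0 : elen e != 0 by rewrite gt_eqF ?elen_gt0.
wlog le_tt : t t' / t <= t' => [wl ht ht'|/andP[t0 tL] /andP[t'0 t'L]].
  have [le_tt|/ltW le_tt] := lerP t t'; first by rewrite wl // min_l.
  by rewrite tentC wl // min_l // [t' * t]mulrC.
rewrite (min_l le_tt); move: t0; rewrite le_eqVlt => /predU1P[<-|t0].
  by rewrite ept_src // tentC tent_vpt; ring.
move: t'L; rewrite le_eqVlt => /predU1P[->|t'L].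
  by rewrite [ept e (elen e)]ept_tgt // tent_vpt; field.
rewrite !ept_interior ?t0 ?(lt_le_trans t0) ?(le_lt_trans le_tt) // => *.
by rewrite /= eqxx min_l.
Qed.

Lemma tent_ept_neq e e' t t' : e != e' -> tent (ept e t) (ept e' t') = 0.
Proof.
move=> ne; rewrite {1}/ept; case: insubP => [z _ ze|_]; last by case: ifP.
rewrite /ept; case: insubP => [z' _ z'e|_]; last by case: ifP.
by rewrite /= ze z'e /= (negbTE ne).
Qed.

(** The retraction of the real line onto the parameter interval, through which [ept e] factors. *)
Definition clamp e t : R := Num.max 0 (Num.min t (elen e)).

Lemma clamp_itv e t : 0 <= clamp e t <= elen e.
Proof. by rewrite /clamp le_max lexx /= ge_max ge_min lexx orbT andbT ltW ?elen_gt0. Qed.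

Lemma ept_clamp e t : ept e (clamp e t) = ept e t.
Proof.
rewrite /clamp; case: (leP t (elen e)) => tL; case: (leP 0 _) => t0 //.
- by rewrite !ept_src // ltW.
- by rewrite !ept_tgt // ltW.
- by have := elen_gt0 e; rewrite ltNge ltW.
Qed.

Lemma clamp_continuous e : continuous (clamp e).
Proof.
move=> t; apply: (@continuous_max R R (cst 0) (fun t => Num.min t (elen e)) t).
  exact: cst_continuous.
apply: (@continuous_min R R id (cst (elen e)) t); first exact: cvg_id.
exact: cst_continuous.
Qed.

(** Continuity is tested edge by edge, as the topology is glued from the edges. The formula [phi e]
    matches [f] only on the parameter interval; composing it with [clamp e] gives agreement on the
    whole line. *)
Lemma gpoint_continuous (f : gpoint G -> R) (phi : edge G -> R -> R) :
  (forall e, continuous (phi e)) ->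
  (forall e t, 0 <= t <= elen e -> f (ept e t) = phi e t) -> continuous f.
Proof.
move=> cphi fphi; apply/continuousP => A oA.
suff : gopen (f @^-1` A) by [].
move=> e; rewrite (_ : ept e @^-1` _ = (phi e \o clamp e) @^-1` A).
  move: A oA; apply/continuousP => t; apply: continuous_comp; last exact: cphi.
  exact: clamp_continuous.
by apply/seteqP; split => t; rewrite /preimage /= -ept_clamp fphi ?clamp_itv.
Qed.

End Points.

(** * One-sided slopes and linearity of the Laplacian *)

Section Slopes.
Variables (R : realType) (G : metrized_graph R).
Implicit Types (t s m : R) (v w : vert G) (e : edge G).
Implicit Types (p q : gpoint G) (f : gpoint G -> R).

(** An exact affine identity for small positive [h], instead of a limit. Such identities combine
    linearly at once, and they guarantee that the [lim] in [slope] is a genuine limit. *)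
Definition has_slope f e t s m :=
  \forall h \near 0^'+, f (ept e (t + s * h)) = f (ept e t) + m * h.

Lemma slopeE f e t s m : has_slope f e t s m -> slope f e t s = m.
Proof.
move=> fm; apply/cvg_lim => //; apply: cvg_near_cst.
near=> h.
have h0 : h != 0 by rewrite gt_eqF //; near: h; exact: nbhs_right_gt.
have -> : f (ept e (t + s * h)) = f (ept e t) + m * h by near: h.
by rewrite addrC addKr mulrCA mulVf // mulr1.
Unshelve. all: by end_near. Qed.

Lemma has_slope_near f e t s m d : 0 < d ->
  (forall h, 0 < h -> h < d -> f (ept e (t + s * h)) = f (ept e t) + m * h) ->
  has_slope f e t s m.
Proof.
move=> d0 fm; near=> h; apply: fm; near: h.
  exact: nbhs_right_gt.
exact: nbhs_right_lt.
Unshelve. all: by end_near. Qed.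

Lemma has_slope_lin f f' e t s m m' c :
  has_slope f e t s m -> has_slope f' e t s m' ->
  has_slope (fun x => c * f x + f' x) e t s (c * m + m').
Proof.
move=> fm fm'; near=> h.
have -> : f (ept e (t + s * h)) = f (ept e t) + m * h by near: h.
have -> : f' (ept e (t + s * h)) = f' (ept e t) + m' * h by near: h.
by ring.
Unshelve. all: by end_near. Qed.

Lemma breakpoint_gap_right (r : seq R) t b : t < b ->
  exists d, [/\ t < d, d <= b & forall u, u \in r -> u \notin `]t, d[].
Proof.
move=> tb; elim: r => [|u r [d [td db rd]]]; first by exists b.
have [tu|ut] := ltP t u.
  exists (Num.min u d); split; rewrite ?lt_min ?tu ?td ?ge_min ?db ?orbT // => w.
  rewrite in_cons => /predU1P[->|/rd]; rewrite !in_itv /= !lt_min.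
    by rewrite ltxx andbF.
  by apply: contra => /and3P[-> _ ->].
exists d; split => // w; rewrite in_cons => /predU1P[->|/rd //].
by rewrite in_itv /= ltNge ut.
Qed.

Lemma breakpoint_gap_left (r : seq R) t a : a < t ->
  exists d, [/\ d < t, a <= d & forall u, u \in r -> u \notin `]d, t[].
Proof.
move=> at_; elim: r => [|u r [d [td db rd]]]; first by exists a.
have [ut|tu] := ltP u t.
  exists (Num.max u d); split; rewrite ?gt_max ?ut ?td ?le_max ?db ?orbT // => w.
  rewrite in_cons => /predU1P[->|/rd]; rewrite !in_itv /= !gt_max.
    by rewrite ltxx.
  by apply: contra => /andP[/andP[_ ->] ->].
exists d; split => // w; rewrite in_cons => /predU1P[->|/rd //].
by rewrite in_itv /= andbC ltNge tu.
Qed.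

(** A finite list of breakpoints leaves a gap just to the right of [t], and on this gap the function
    is affine. *)
Lemma pa_slope_right f e t : piecewise_affine f -> 0 <= t < elen e ->
  exists m, has_slope f e t 1 m.
Proof.
move=> /(_ e)[r fr] /andP[t0 tL].
have [d [td dL rd]] := breakpoint_gap_right r tL.
have [m [c fE]] := fr t d t0 dL rd.
exists m; apply: (@has_slope_near _ _ _ _ _ (d - t)); first by rewrite subr_gt0.
move=> h h0 hd; rewrite !fE ?in_itv /=; first by ring.
  by rewrite lexx ltW.
by apply/andP; split; lra.
Qed.

Lemma pa_slope_left f e t : piecewise_affine f -> 0 < t <= elen e ->
  exists m, has_slope f e t (-1) m.
Proof.
move=> /(_ e)[r fr] /andP[t0 tL].
have [d [td dL rd]] := breakpoint_gap_left r t0.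
have [m [c fE]] := fr d t dL tL rd.
exists (- m); apply: (@has_slope_near _ _ _ _ _ (t - d)); first by rewrite subr_gt0.
move=> h h0 hd; rewrite !fE ?in_itv /=; first by ring.
  by rewrite lexx ltW.
by apply/andP; split; lra.
Qed.

Lemma pa_lin f f' c : piecewise_affine f -> piecewise_affine f' ->
  piecewise_affine (fun x => c * f x + f' x).
Proof.
move=> fpa fpa' e; have [r fr] := fpa e; have [r' fr'] := fpa' e.
exists (r ++ r') => a b a0 bL rab.
have [|m [k fE]] := fr a b a0 bL.
  by move=> u ur; apply: rab; rewrite mem_cat ur.
have [|m' [k' fE']] := fr' a b a0 bL.
  by move=> u ur; apply: rab; rewrite mem_cat ur orbT.
exists (c * m + m'), (c * k + k') => t tab; rewrite fE // fE' //; ring.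
Qed.

Lemma slope_right_lin f f' c e t : piecewise_affine f -> piecewise_affine f' ->
  0 <= t < elen e ->
  slope (fun x => c * f x + f' x) e t 1 = c * slope f e t 1 + slope f' e t 1.
Proof.
move=> /(@pa_slope_right _ e t) fpa /(@pa_slope_right _ e t) fpa' tL.
have [m fm] := fpa tL; have [m' fm'] := fpa' tL.
by rewrite (slopeE (has_slope_lin c fm fm')) (slopeE fm) (slopeE fm').
Qed.

Lemma slope_left_lin f f' c e t : piecewise_affine f -> piecewise_affine f' ->
  0 < t <= elen e ->
  slope (fun x => c * f x + f' x) e t (-1) = c * slope f e t (-1) + slope f' e t (-1).
Proof.
move=> /(@pa_slope_left _ e t) fpa /(@pa_slope_left _ e t) fpa' tL.
have [m fm] := fpa tL; have [m' fm'] := fpa' tL.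
by rewrite (slopeE (has_slope_lin c fm fm')) (slopeE fm) (slopeE fm').
Qed.

Lemma laplacian_ept f e t : 0 < t < elen e ->
  laplacian f (ept e t) = - (slope f e t 1 + slope f e t (-1)).
Proof. by move=> te; rewrite ept_interior. Qed.

(** Piecewise affinity provides every slope that enters the Laplacian as an actual value of
    [has_slope], so the limits may be combined linearly. *)
Lemma laplacian_lin f f' c p : piecewise_affine f -> piecewise_affine f' ->
  laplacian (fun x => c * f x + f' x) p = c * laplacian f p + laplacian f' p.
Proof.
move=> fpa fpa'; elim/gpoint_case: p => [v|e t /andP[t0 tL]].
  rewrite /laplacian /=.
  under eq_bigr do rewrite slope_right_lin // ?lexx ?elen_gt0 //.
  under [X in _ + X]eq_bigr do rewrite slope_left_lin // ?lexx ?elen_gt0 //.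
  by rewrite !big_split /= -!mulr_sumr; ring.
rewrite !laplacian_ept ?t0 //.
by rewrite slope_right_lin ?slope_left_lin ?t0 ?tL ?(ltW t0) ?(ltW tL) //; ring.
Qed.

Lemma pa_interp (u : vert G -> R) : piecewise_affine (interp u).
Proof.
move=> e; exists [::] => a b a0 bL _.
exists ((u (tgt e) - u (src e)) / elen e), (u (src e)) => t.
rewrite in_itv /= => /andP[at_ tb].
rewrite interp_ept ?(le_trans a0) ?(le_trans tb) //; ring.
Qed.

Lemma pa_cst c : piecewise_affine ((fun=> c) : gpoint G -> R).
Proof.
by move=> e; exists [::] => a b _ _ _; exists 0, c => t _; rewrite mul0r add0r.
Qed.

Lemma pa_tent q : piecewise_affine (fun p => tent p q).
Proof.
elim/gpoint_case: q => [v|e' t' te'] e.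
  by exists [::] => a b _ _ _; exists 0, 0 => t _; rewrite tent_vpt; ring.
have [ee|ne] := eqVneq e e'; last first.
  by exists [::] => a b _ _ _; exists 0, 0 => t _; rewrite tent_ept_neq //; ring.
rewrite -{}ee in te' *.
have L0 : elen e != 0 by rewrite gt_eqF ?elen_gt0.
exists [:: t'] => a b a0 bL /(_ t' (mem_head _ _)).
have [t'0 t'L] := andP te'.
rewrite in_itv negb_and -!leNgt => /orP[t'a|bt'].
  exists (- t' / elen e), t' => t; rewrite in_itv /= => /andP[at_ tb].
  by rewrite tent_ept ?min_r; [ring|lra|apply/andP; split; lra..].
exists (1 - t' / elen e), 0 => t; rewrite in_itv /= => /andP[at_ tb].
by rewrite tent_ept ?min_l; [ring|lra|apply/andP; split; lra..].
Qed.

(** The tent rises up to its peak at [t'] and falls afterwards. At [t = t'] the rightward slope is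
    already the falling one, hence the strict comparison here; the leftward slope still sees the
    rising piece, hence [<=] in [tent_slope_left]. *)
Lemma tent_slope_right e t t' : 0 < t' < elen e -> 0 <= t < elen e ->
  has_slope (fun p => tent p (ept e t')) e t 1 ((t < t')%R%:R - t' / elen e).
Proof.
move=> /andP[t'0 t'L] /andP[t0 tL].
have [tt|tt] := ltP t t'.
  apply: (@has_slope_near _ _ _ _ _ (t' - t)) => [|h h0 hL]; first lra.
  by rewrite !tent_ept ?min_l; [rewrite /=; ring|try lra; apply/andP; split; lra..].
apply: (@has_slope_near _ _ _ _ _ (elen e - t)) => [|h h0 hL]; first lra.
by rewrite !tent_ept ?min_r; [rewrite /=; ring|try lra; apply/andP; split; lra..].
Qed.

Lemma tent_slope_left e t t' : 0 < t' < elen e -> 0 < t <= elen e ->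
  has_slope (fun p => tent p (ept e t')) e t (-1) (t' / elen e - (t <= t')%R%:R).
Proof.
move=> /andP[t'0 t'L] /andP[t0 tL].
have [tt|tt] := leP t t'.
  apply: (@has_slope_near _ _ _ _ _ t) => [|h h0 hL]; first lra.
  by rewrite !tent_ept ?min_l; [rewrite /=; ring|try lra; apply/andP; split; lra..].
apply: (@has_slope_near _ _ _ _ _ (t - t')) => [|h h0 hL]; first lra.
by rewrite !tent_ept ?min_r; [rewrite /=; ring|try lra; apply/andP; split; lra..].
Qed.

Lemma tent_slope_neq e e' t t' s : e != e' ->
  has_slope (fun p => tent p (ept e' t')) e t s 0.
Proof.
by move=> ne; apply: nearW => h; rewrite !tent_ept_neq // mul0r addr0.
Qed.

Lemma interp_slope (u : vert G -> R) e t s : 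
  (0 <= t < elen e /\ s = 1) \/ (0 < t <= elen e /\ s = -1) ->
  has_slope (interp u) e t s (s * (u (tgt e) - u (src e)) / elen e).
Proof.
have L0 : elen e != 0 by rewrite gt_eqF ?elen_gt0.
case=> [] [/andP[t0 tL] ->].
  apply: (@has_slope_near _ _ _ _ _ (elen e - t)) => [|h h0 hL]; first lra.
  by rewrite !interp_ept; [field|apply/andP; split; lra..].
apply: (@has_slope_near _ _ _ _ _ t) => [|h h0 hL]; first lra.
by rewrite !interp_ept; [field|apply/andP; split; lra..].
Qed.

End Slopes.

(** Induction on the number of breakpoints: a breakpoint inside the interval splits it into two
    pieces, each with fewer breakpoints and so affine. The second hypothesis, the vanishing of the
    Laplacian inside an edge, makes the two slopes equal. *)
Lemma affine_of_no_bend (R : realType) (phi : R -> R) (r : seq R) (A B : R) :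
  (forall a b, A <= a -> b <= B -> (forall u, u \in r -> u \notin `]a, b[) ->
     exists m c : R, forall t, t \in `[a, b] -> phi t = m * t + c) ->
  (forall t m m' d, A < t < B -> 0 < d ->
     (forall h, 0 < h -> h < d -> phi (t + h) = phi t + m * h) ->
     (forall h, 0 < h -> h < d -> phi (t - h) = phi t + m' * h) -> m + m' = 0) ->
  exists m c : R, forall t, t \in `[A, B] -> phi t = m * t + c.
Proof.
elim: {r}(size r) {-2}r (leqnn (size r)) A B => [|n IHn] r.
  by rewrite leqn0 size_eq0 => /eqP-> A B paf _; exact: paf.
move=> rn A B paf no_bend.
have [|/hasPn noU] := boolP (has (mem `]A, B[) r); last exact: paf.
case/hasP => u ur; rewrite -[mem _ u]/(u \in _) in_itv /= => /andP[Au uB].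
have remn : (size (rem u r) <= n)%N.
  by rewrite size_rem // -ltnS prednK // -has_predT; apply/hasP; exists u.
have [||m1 [c1 E1]] := IHn _ remn A u.
- move=> a b Aa bu nor; apply: paf => // [|w wr]; first by rewrite (le_trans bu) ?ltW.
  have [->|wu] := eqVneq w u; first by rewrite in_itv /= [u < b]ltNge bu andbF.
  by apply: nor; rewrite rem_mem.
- by move=> t m m' d /andP[At tu]; apply: no_bend; rewrite At (lt_trans tu).
have [||m2 [c2 E2]] := IHn _ remn u B.
- move=> a b ua bB nor; apply: paf => // [|w wr]; first by rewrite (le_trans _ ua) ?ltW.
  have [->|wu] := eqVneq w u; first by rewrite in_itv /= ltNge ua.
  by apply: nor; rewrite rem_mem.
- by move=> t m m' d /andP[ut tB]; apply: no_bend; rewrite tB (lt_trans Au).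
have uE1 := E1 u; have uE2 := E2 u.
rewrite !in_itv /= !lexx ?(ltW Au) ?(ltW uB) in uE1 uE2.
(* At [u] the slope to the right is [m2]; the slope to the left, taken in the decreasing direction,
   is [- m1]. *)
have m12 : m2 + - m1 = 0.
  apply: (no_bend u _ _ (Num.min (u - A) (B - u))) => [||h h0|h h0].
  - by rewrite Au.
  - by rewrite lt_min !subr_gt0 Au.
  - rewrite lt_min => /andP[hA hB]; rewrite uE2 // E2; first ring.
    by rewrite in_itv /=; apply/andP; split; lra.
  - rewrite lt_min => /andP[hA hB]; rewrite uE1 // E1; first ring.
    by rewrite in_itv /=; apply/andP; split; lra.
have := uE1 isT; rewrite uE2 //.
have -> : m2 = m1 by lra.
move/addrI => c12; exists m1, c1 => t; rewrite in_itv /= => /andP[At tB].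
have [tu|/ltW ut] := leP t u; first by rewrite E1 // in_itv /= At.
by rewrite E2 ?in_itv /= ?ut // c12; congr (_ * _ + _); lra.
Qed.

Lemma continuous_lin (T : topologicalType) (R : realType) (f g : T -> R) (c : R) :
  continuous f -> continuous g -> continuous (fun p => c * f p + g p).
Proof.
by move=> cf cg p; apply: cvgD; [apply: cvgMl_tmp; exact: cf|exact: cg].
Qed.

Lemma continuous_scale (T : topologicalType) (R : realType) (f : T -> R) (c : R) :
  continuous f -> continuous (fun p => c * f p).
Proof. by move=> cf p; apply: cvgMl_tmp; exact: cf. Qed.

(** * The symmetric kernel, and existence and uniqueness of the voltage function *)

Section Kernel.
Variables (R : realType) (G : metrized_graph R).
Implicit Types (u : vert G -> R) (t : R) (v w : vert G) (e : edge G).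
Implicit Types (p q x y z : gpoint G) (f : gpoint G -> R).

Lemma slope_interp_right u e t : 0 <= t < elen e ->
  slope (interp u) e t 1 = (u (tgt e) - u (src e)) / elen e.
Proof.
by move=> te; rewrite (slopeE (interp_slope _ (or_introl (conj te erefl)))) mul1r.
Qed.

Lemma slope_interp_left u e t : 0 < t <= elen e ->
  slope (interp u) e t (-1) = (u (src e) - u (tgt e)) / elen e.
Proof.
move=> te; rewrite (slopeE (interp_slope _ (or_intror (conj te erefl)))).
by rewrite mulN1r opprB.
Qed.

Lemma laplacian_interp_vpt u v : laplacian (interp u) (vpt v) = vlap u v.
Proof.
rewrite /laplacian /= opprD -!sumrN big_mkcond [X in _ + X]big_mkcond -big_split.
apply: eq_bigr => e _ /=.
rewrite slope_interp_right ?slope_interp_left ?lexx ?elen_gt0 //.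
by rewrite /bdry; case: eqP; case: eqP => _ _ /=; ring.
Qed.

Lemma laplacian_interp_ept u e t : 0 < t < elen e ->
  laplacian (interp u) (ept e t) = 0.
Proof.
move=> /andP[t0 tL]; rewrite laplacian_ept ?t0 //.
by rewrite slope_interp_right ?slope_interp_left ?t0 ?tL ?ltW //; ring.
Qed.

Lemma laplacian_cst c p : laplacian (fun=> c) p = 0.
Proof.
have -> : (fun=> c) = interp (fun=> c) :> (gpoint G -> R).
  by apply/funext => q; rewrite interp_cst.
elim/gpoint_case: p => [v|e t te]; last exact: laplacian_interp_ept.
by rewrite laplacian_interp_vpt /vlap big1 // => e _; rewrite subrr mulr0 mul0r.
Qed.

Lemma eq_vpt v w : (vpt v == vpt w) = (v == w).
Proof. by []. Qed.

Lemma eq_vpt_ept v e t : 0 < t < elen e -> (vpt v == ept e t) = false.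
Proof. by move=> te; rewrite ept_interior. Qed.

Lemma eq_ept e t e' t' : 0 < t < elen e -> 0 < t' < elen e' ->
  (ept e t == ept e' t') = (e == e') && (t == t').
Proof. by move=> te te'; rewrite !ept_interior. Qed.

Lemma laplacian_tent_vpt q v :
  laplacian (fun p => tent p q) (vpt v) =
  (vpt v == q)%:R - interp (fun a => (a == v)%:R) q.
Proof.
elim/gpoint_case: q => [w|e t te].
  have -> : (fun p => tent p (vpt w)) = (fun=> 0) by apply/funext => p; rewrite tent_vpt.
  by rewrite laplacian_cst eq_vpt eq_sym subrr.
have [t0 tL] := andP te.
have Le := elen_gt0 e.
rewrite eq_vpt_ept // interp_ept ?ltW // sub0r /laplacian /=; congr (- (_ + _)).
  (* Only the edge carrying [q] has nonzero slopes. Its start receives [1 - t / elen e] and its end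
     [t / elen e], the barycentric weights of [q]. *)
  rewrite -(sum_pick e (fun e' => (1 - t / elen e) * (src e' == v)%:R)) [LHS]big_mkcond.
  apply: eq_bigr => e' _; have [<-|ne] := eqVneq e e'.
    rewrite (slopeE (tent_slope_right te _)) ?lexx // t0.
    by case: eqP => _ /=; ring.
  rewrite mul0r; case: ifP => // _.
  by rewrite (slopeE (@tent_slope_neq _ _ e' e 0 t 1 _)) // eq_sym.
rewrite -(sum_pick e (fun e' => t / elen e * (tgt e' == v)%:R)) [LHS]big_mkcond.
apply: eq_bigr => e' _; have [<-|ne] := eqVneq e e'.
  rewrite (slopeE (tent_slope_left te _)) ?lexx ?Le // leNgt tL.
  by case: eqP => _ /=; ring.
rewrite mul0r; case: ifP => // _.
by rewrite (slopeE (@tent_slope_neq _ _ e' e _ t _ _)) // eq_sym.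
Qed.

Lemma laplacian_tent_ept q e t : 0 < t < elen e ->
  laplacian (fun p => tent p q) (ept e t) = (ept e t == q)%:R.
Proof.
move=> te; have [t0 tL] := andP te.
elim/gpoint_case: q => [w|e' t' te'].
  have -> : (fun p => tent p (vpt w)) = (fun=> 0) by apply/funext => p; rewrite tent_vpt.
  by rewrite laplacian_cst eq_sym eq_vpt_ept.
rewrite laplacian_ept // eq_ept //; have [ee|ne] := eqVneq e e'; last first.
  by rewrite !(slopeE (@tent_slope_neq _ _ e e' t t' _ _)) // addr0 oppr0.
rewrite -{}ee in te' *.
rewrite (slopeE (tent_slope_right te' _)) ?(ltW t0) ?tL //.
rewrite (slopeE (tent_slope_left te' _)) ?(ltW tL) ?t0 //.
by case: (ltgtP t t') => _ /=; ring.
Qed.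

Lemma affine_continuous (m c : R) : continuous (fun t => m * t + c).
Proof. by move=> t; apply: cvgD; [apply: cvgMl_tmp; exact: cvg_id|exact: cvg_cst]. Qed.

Lemma interp_continuous u : continuous (interp u).
Proof.
apply: (@gpoint_continuous _ _ _ (fun e t =>
  (u (tgt e) - u (src e)) / elen e * t + u (src e))) => [e|e t te].
  exact: affine_continuous.
by rewrite interp_ept //; ring.
Qed.

Lemma tent_continuous q : continuous (fun p => tent p q).
Proof.
elim/gpoint_case: q => [v|e t te].
  rewrite (_ : (fun p => _) = fun=> 0); first exact: cst_continuous.
  by apply/funext => p; rewrite tent_vpt.
apply: (@gpoint_continuous _ _ _ (fun e' s => if e' == e then
  Num.min s t + (- (t / elen e) * s + 0) else 0)) => [e'|e' s se].
  case: (e' == e) => s; last exact: cvg_cst.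
  apply: cvgD; last exact: affine_continuous.
  by apply: (@continuous_min R R id (cst t) s); [exact: cvg_id|exact: cvg_cst].
case: ifP => [/eqP ee|/negbT ne]; last by rewrite tent_ept_neq.
rewrite {}ee in se *; case/andP: te => t0 tL.
by rewrite tent_ept // ?ltW //; ring.
Qed.

Definition vlap_inv : vert G -> vert G -> R := sval (cid (vlap_sym_inverse G)).

Lemma vlap_invC a b : vlap_inv a b = vlap_inv b a.
Proof. by rewrite /vlap_inv; case: cid => g [gC gE]; exact: gC. Qed.

Lemma vlap_vlap_inv b v :
  vlap (vlap_inv b) v = (b == v)%:R - #|vert G|%:R^-1.
Proof. by rewrite /vlap_inv; case: cid => g [gC gE]; exact: gE. Qed.

(** The vertex potential whose Laplacian is the barycentric mass of [q] minus the uniform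
    probability on the vertices. *)
Definition pot q : vert G -> R := fun a => interp (vlap_inv a) q.

Lemma vlap_pot q v :
  vlap (pot q) v = interp (fun a => (a == v)%:R) q - #|vert G|%:R^-1.
Proof.
rewrite /pot; have -> : (fun a => interp (vlap_inv a) q) =
    (fun a => interp (fun b => vlap_inv b a) q).
  by apply/funext => a; congr interp; apply/funext => b; exact: vlap_invC.
rewrite vlap_interp -[X in _ = _ - X](interp_cst _ q) -interp_sub.
by congr interp; apply/funext => b; exact: vlap_vlap_inv.
Qed.

Definition gker p q : R := interp (pot q) p + tent p q.

Lemma gkerC p q : gker p q = gker q p.
Proof.
rewrite /gker tentC /pot interp_exchange; congr (interp _ _ + _).
by apply/funext => b; congr interp; apply/funext => a; exact: vlap_invC.
Qed.

Lemma gker_continuous q : continuous (fun p => gker p q).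
Proof.
by move=> p; exact: (cvgD (@interp_continuous (pot q) p) (@tent_continuous q p)).
Qed.

Lemma pa_gker q : piecewise_affine (fun p => gker p q).
Proof.
have := pa_lin 1 (pa_interp (pot q)) (pa_tent q).
by under eq_fun do rewrite mul1r.
Qed.

(** The barycentric masses produced by [pot q] cancel those removed by the tent. What remains
    besides the point mass at [q] is the uniform measure on the vertices, the same for every [q]. *)
Lemma laplacian_gker q p : laplacian (fun p => gker p q) p =
  (p == q)%:R - (if p is inl _ then #|vert G|%:R^-1 else 0).
Proof.
have -> : (fun p => gker p q) = (fun p => 1 * interp (pot q) p + tent p q).
  by apply/funext => x; rewrite mul1r.
rewrite laplacian_lin; [|exact: pa_interp|exact: pa_tent].
elim/gpoint_case: p => [v|e t te].
  by rewrite laplacian_interp_vpt laplacian_tent_vpt vlap_pot /=; ring.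
by rewrite laplacian_interp_ept // laplacian_tent_ept // ept_interior /=; ring.
Qed.

(** The uniform backgrounds of the two kernels cancel in the difference, and the last two terms,
    constant in [p], normalize the value at [z] to 0. *)
Definition volt z y p := gker p y - gker p z - gker z y + gker z z.

Lemma is_voltage_volt z y : is_voltage z y (volt z y).
Proof.
have voltE : volt z y = (fun p => -1 * gker p z + (1 * gker p y + (gker z z - gker z y))).
  by apply/funext => p; rewrite /volt; ring.
have pay : piecewise_affine (fun p => 1 * gker p y + (gker z z - gker z y)).
  by apply: pa_lin; [exact: pa_gker|exact: pa_cst].
split; last 1 first.
- move=> p; rewrite voltE !laplacian_lin //; try exact: pa_gker; try exact: pa_cst.
  by rewrite laplacian_cst !laplacian_gker; ring.
- by rewrite voltE; do 2![apply: continuous_lin; first exact: gker_continuous];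
    move=> p; exact: cst_continuous.
- by rewrite voltE; apply: pa_lin => //; exact: pa_gker.
- by rewrite /volt; ring.
Qed.

Lemma laplacian_eq0_const f : piecewise_affine f ->
  (forall p, laplacian f p = 0) -> forall p q, f p = f q.
Proof.
move=> paf lap0.
(* Zero Laplacian inside the edges means no bend there, so [f] is determined by its vertex values,
   and these are harmonic for [vlap]. *)
have f_interp : f = interp (fun v => f (vpt v)).
  apply/funext; elim/gpoint_case => [//|e t te].
  have [r fr] := paf e.
  have [||m [c fE]] :=
    @affine_of_no_bend R (fun s => f (ept e s)) r 0 (elen e).
  - exact: fr.
  - move=> t' m m' d /andP[t0 tL] d0 fm fm'.
    have := lap0 (ept e t'); rewrite laplacian_ept ?t0 // => /eqP.
    rewrite oppr_eq0 => /eqP <-; congr (_ + _); apply/esym/slopeE.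
      by apply: (has_slope_near d0) => h h0 hd; rewrite mul1r fm.
    by apply: (has_slope_near d0) => h h0 hd; rewrite mulN1r fm'.
  have L0 := elen_gt0 e; have L0' : elen e != 0 by rewrite gt_eqF.
  have [t0 tL] := andP te.
  have ff := fE 0; have fL := fE (elen e); have ft := fE t.
  rewrite !in_itv /= !lexx ?(ltW L0) ?(ltW t0) ?(ltW tL) in ff fL ft.
  rewrite interp_ept ?(ltW t0) ?(ltW tL) //.
  by rewrite -(ept_src e (lexx 0)) -(ept_tgt (lexx (elen e))) ff // fL // ft //; field.
have lap0' v : vlap (fun v => f (vpt v)) v = 0.
  by rewrite -laplacian_interp_vpt -f_interp.
have fc := vlap_eq0_const lap0'.
move=> p q; rewrite f_interp.
have -> : (fun v => f (vpt v)) = (fun=> f point) by apply/funext => v; exact: fc.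
by rewrite !interp_cst.
Qed.

Lemma is_voltage_unique z y f f' : is_voltage z y f -> is_voltage z y f' -> f = f'.
Proof.
move=> [_ paf fz lapf] [_ paf' fz' lapf'].
have paD : piecewise_affine (fun p => -1 * f' p + f p) by exact: pa_lin.
have lapD p : laplacian (fun p => -1 * f' p + f p) p = 0.
  by rewrite laplacian_lin // lapf lapf'; ring.
apply/funext => p; have := laplacian_eq0_const paD lapD p z.
by rewrite fz fz'; lra.
Qed.

(** [xget] returns [volt z y], because the difference of two candidates is harmonic and vanishes at
    [z]. *)
Lemma voltageE z x y :
  voltage z x y = gker x y - gker x z - gker z y + gker z z.
Proof.
rewrite /voltage (@xget_unique _ _ _ (volt z y)) //; first exact: is_voltage_volt.
by move=> f /is_voltage_unique; apply; exact: is_voltage_volt.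
Qed.

Lemma resistanceE x y : resistance x y = gker x x - 2 * gker x y + gker y y.
Proof. by rewrite /resistance voltageE [gker y x]gkerC; ring. Qed.

Lemma resistanceC x y : resistance x y = resistance y x.
Proof. by rewrite !resistanceE [gker y x]gkerC; ring. Qed.

Lemma voltage_resistance z x y :
  voltage z x y = 2^-1 * (resistance x z + resistance y z - resistance x y).
Proof. by rewrite voltageE !resistanceE [gker z y]gkerC; field. Qed.

End Kernel.

(** * Effective resistance along an edge and across a bridge *)

Section Resistance.
Variables (R : realType) (G : metrized_graph R).
Implicit Types (u : vert G -> R) (t : R) (v w : vert G) (e : edge G).
Implicit Types (p q x y z : gpoint G) (f : gpoint G -> R).

Lemma resistance0 x : resistance x x = 0.
Proof. by rewrite resistanceE; ring. Qed.

Lemma gker_ept e t q : 0 <= t <= elen e ->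
  gker (ept e t) q = (1 - t / elen e) * gker (vpt (src e)) q +
    t / elen e * gker (vpt (tgt e)) q + tent (ept e t) q.
Proof.
by move=> te; rewrite /gker interp_ept // !(tentC (vpt _)) !tent_vpt /=; ring.
Qed.

Lemma gker_ept_ept e t t' : 0 <= t <= elen e -> 0 <= t' <= elen e ->
  let s := t / elen e in let s' := t' / elen e in
  gker (ept e t) (ept e t') =
    (1 - s) * (1 - s') * gker (vpt (src e)) (vpt (src e)) +
    ((1 - s) * s' + s * (1 - s')) * gker (vpt (src e)) (vpt (tgt e)) +
    s * s' * gker (vpt (tgt e)) (vpt (tgt e)) +
    (Num.min t t' - t * t' / elen e).
Proof.
move=> te te' s s'; rewrite gker_ept // tent_ept // ![gker (vpt _) (ept _ _)]gkerC.
rewrite !(gker_ept _ te') !tent_vpt [gker (vpt (tgt e)) (vpt (src e))]gkerC.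
by rewrite /s /s'; ring.
Qed.

(** When the tent term vanishes, for instance for [p] outside the interior of [e], [gker p] is
    affine along [e]. The quadratic term comes from the diagonal value of the kernel, whose tent
    part is [elen e * s * (1 - s)]. *)
Lemma resistance_ept p e t : 0 <= t <= elen e -> tent p (ept e t) = 0 ->
  let s := t / elen e in
  resistance p (ept e t) = (1 - s) * resistance p (vpt (src e)) +
    s * resistance p (vpt (tgt e)) +
    s * (1 - s) * (elen e - resistance (vpt (src e)) (vpt (tgt e))).
Proof.
move=> te pe s; have L0 : elen e != 0 by rewrite gt_eqF ?elen_gt0.
rewrite !resistanceE gker_ept_ept // minxx [gker p (ept e t)]gkerC gker_ept //.
rewrite tentC pe ![gker (vpt _) p]gkerC /s; field; exact: L0.
Qed.

Lemma resistance_same_edge e t t' : 0 <= t <= elen e -> 0 <= t' <= elen e ->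
  resistance (ept e t) (ept e t') = `|t - t'| -
    (t - t') ^+ 2 / elen e ^+ 2 * (elen e - resistance (vpt (src e)) (vpt (tgt e))).
Proof.
move=> te te'; have L0 : elen e != 0 by rewrite gt_eqF ?elen_gt0.
have -> : `|t - t'| = t + t' - 2 * Num.min t t'.
  by have [tt|tt] := leP t t'; [rewrite ler0_norm|rewrite gtr0_norm]; lra.
by rewrite !resistanceE !gker_ept_ept // !minxx; field; exact: L0.
Qed.

(** Continuity in each variable does not suffice on the diagonal; there the kernel is an explicit
    quadratic polynomial along each edge. *)
Lemma gker_diag_continuous : continuous (fun p : gpoint G => gker p p).
Proof.
pose K (a b : vert G) := gker (vpt a) (vpt b).
apply: (@gpoint_continuous _ _ _ (fun e t =>
   ((((K (src e) (src e) - 2 * K (src e) (tgt e) + K (tgt e) (tgt e)) / elen e ^+ 2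
     - (elen e)^-1) * t + (2 * (K (src e) (tgt e) - K (src e) (src e)) / elen e + 1)) * t
   + K (src e) (src e)))) => [e t|e t te].
  apply: cvgD; last exact: cvg_cst.
  by apply: cvgM; [exact: affine_continuous|exact: cvg_id].
have L0 : elen e != 0 by rewrite gt_eqF ?elen_gt0.
by rewrite gker_ept_ept // minxx /K; field; exact: L0.
Qed.

Lemma resistance_continuous x : continuous (resistance x).
Proof.
have -> : resistance x = (fun z => -2 * gker z x + (1 * gker z z + gker x x)).
  by apply/funext => z; rewrite resistanceE [gker x z]gkerC; ring.
apply: continuous_lin; first exact: gker_continuous.
apply: continuous_lin; first exact: gker_diag_continuous.
by move=> p; exact: cst_continuous.
Qed.

Lemma graph_adj_sym (A : pred (edge G)) : symmetric (graph_adj (@src R G) (@tgt R G) A).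
Proof. by move=> a b; apply: eq_existsb => e; rewrite orbC. Qed.

Lemma connected_withoutC e a b : connected_without e a b = connected_without e b a.
Proof. exact/sym_connect_sym/graph_adj_sym. Qed.

Lemma connected_without_edge e e' : e' != e -> connected_without e (src e') (tgt e').
Proof. by move=> ee; apply/connect1/existsP; exists e'; rewrite inE /= ee !eqxx. Qed.

(** If the ends of [e] were joined without [e], every passage through [e] could be rerouted and the
    graph without [e] would be connected. *)
Lemma bridge_separates e : is_bridge e -> ~~ connected_without e (src e) (tgt e).
Proof.
move=> br; apply/negP => st; apply: br => a b.
apply: connect_sub (graph_connected a b) => c d /existsP[e' /andP[_ cd]].
have con : connected_without e (src e') (tgt e').
  by have [->|ne] := eqVneq e' e; last exact: connected_without_edge.
case/orP: cd => /andP[/eqP<- /eqP<-] //.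
by rewrite -/(connected_without _ _ _) connected_withoutC.
Qed.

(* The vertex potential on the right drops only along e, so a unit current from
   tgt e to src e flows through e alone. *)
Lemma bridge_voltage e p : is_bridge e ->
  voltage (vpt (src e)) p (vpt (tgt e)) =
  interp (fun v => if connected_without e (src e) v then 0 else elen e) p.
Proof.
move=> br; set u := (fun v => _).
have u_src : u (src e) = 0 by rewrite /u /connected_without connect0.
have u_tgt : u (tgt e) = elen e by rewrite /u (negbTE (bridge_separates br)).
have L0 : elen e != 0 by rewrite gt_eqF ?elen_gt0.
have lap_u v : vlap u v = (tgt e == v)%:R - (src e == v)%:R.
  rewrite /vlap (bigD1 e) //= u_src u_tgt big1 => [|e' ee]; first by rewrite /bdry; field.
  (* Every other edge stays on one side of the bridge, so [u] takes the same value at both of its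
     ends. *)
  have con := connected_without_edge ee.
  have -> : u (src e') = u (tgt e').
    rewrite /u; congr (if _ then _ else _).
    exact: (same_connect_r (sym_connect_sym (@graph_adj_sym _)) con).
  by rewrite subrr mulr0 mul0r.
(* Both the kernel difference and [u] are potentials of the same unit dipole on the ends of [e];
   their difference is harmonic, hence constant. *)
pose d v := pot (vpt (tgt e)) v - pot (vpt (src e)) v - u v.
have d_cst : forall a b, d a = d b.
  apply: vlap_eq0_const => v; rewrite /d vlap_sub vlap_sub lap_u !vlap_pot /=; ring.
have interp_d q : interp d q = gker q (vpt (tgt e)) - gker q (vpt (src e)) - interp u q.
  by rewrite /d !interp_sub /gker !tent_vpt; ring.
have d_eq : interp d p = interp d (vpt (src e)).
  have -> : d = (fun=> d (src e)) by apply/funext => a; exact: d_cst.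
  by rewrite !interp_cst.
rewrite voltageE; move: d_eq; rewrite !interp_d /= u_src; lra.
Qed.

(** Polarization of [bridge_voltage]. Its instance at [p = tgt e] says that the resistance between
    the ends of a bridge is the length of the bridge. *)
Lemma resistance_bridge e p : is_bridge e ->
  resistance p (vpt (tgt e)) = resistance p (vpt (src e)) + elen e - 2 *
    interp (fun v => if connected_without e (src e) v then 0 else elen e) p.
Proof.
move=> br; have := bridge_voltage p br; have := bridge_voltage (vpt (tgt e)) br.
rewrite !voltage_resistance resistance0 /= (negbTE (bridge_separates br)); lra.
Qed.

Lemma component_tent e a p t : component_without e a p -> tent p (ept e t) = 0.
Proof.
elim/gpoint_case: p => [v _|e' t' te']; first by rewrite tentC tent_vpt.
rewrite /component_without ept_interior // => /andP[ne _].
by rewrite -ept_interior tent_ept_neq.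
Qed.

Lemma component_interp e a p u c : component_without e a p ->
  (forall v, connected_without e a v -> u v = c) -> interp u p = c.
Proof.
move=> + uc; case: p => [v /uc //|[[e' t'] te']] /= /andP[ee con].
rewrite !uc //; first by ring.
exact: connect_trans con (connected_without_edge ee).
Qed.

(** The resistance between the ends of [e] equals [elen e], which kills the quadratic term of
    [resistance_ept]. On this side the potential of the bridge is 0, so the remaining affine
    function has slope 1. *)
Lemma resistance_bridge_src e p t : is_bridge e -> 0 <= t <= elen e ->
  component_without e (src e) p ->
  resistance p (ept e t) = t + resistance p (vpt (src e)).
Proof.
move=> br te pe; have L0 : elen e != 0 by rewrite gt_eqF ?elen_gt0.
rewrite resistance_ept ?(component_tent _ pe) // !resistance_bridge //.
rewrite (component_interp pe (c := 0)) => [|v ->//].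
by rewrite resistance0 /= /connected_without connect0; field; exact: L0.
Qed.

Lemma resistance_bridge_tgt e p t : is_bridge e -> 0 <= t <= elen e ->
  component_without e (tgt e) p ->
  resistance p (ept e t) = elen e - t + resistance p (vpt (tgt e)).
Proof.
move=> br te pe; have L0 : elen e != 0 by rewrite gt_eqF ?elen_gt0.
rewrite resistance_ept ?(component_tent _ pe) // !resistance_bridge //.
(* On the far side the potential is [elen e]: a vertex joined both to [src e] and to [tgt e] would
   contradict the separation by the bridge. *)
rewrite (component_interp pe (c := elen e)) => [|v tv]; last first.
  case: ifP => // sv; case/negP: (bridge_separates br).
  by apply: connect_trans sv _; rewrite -/(connected_without e v (tgt e)) connected_withoutC.
by rewrite resistance0 /= /connected_without connect0; field; exact: L0.
Qed.

End Resistance.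

(** * Integration against a signed measure and the formula for the Green function *)

Section ChargeIntegral.
Variables (R : realType) (G : metrized_graph R).
Variable mu : {charge set (gborel G) -> \bar R}.
Implicit Types f g : gpoint G -> R.

Lemma continuous_ept f e : continuous f -> continuous (fun t : R => f (ept e t)).
Proof.
move=> /continuousP cf; apply/continuousP => A oA.
by have : gopen (f @^-1` A) := cf A oA; apply.
Qed.

(** The extreme value theorem bounds [f] on each of the finitely many edges. The vertices enter the
    sum separately, since a graph may have a vertex and no edge. *)
Lemma gpoint_continuous_bounded f : continuous f -> exists M, forall p, `|f p| <= M.
Proof.
move=> cf.
have /choice[M fM] : forall e : edge G, exists M, forall t, 0 <= t <= elen e ->
    `|f (ept e t)| <= M.
  move=> e; have := @EVT_max R (fun t => `|f (ept e t)|) 0 (elen e) (ltW (elen_gt0 e)).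
  case=> [|c _ cM]; last by exists `|f (ept e c)|.
  apply: continuous_subspaceT => t; apply: cvg_norm.
  exact: (continuous_ept cf).
exists (\sum_e `|M e| + \sum_v `|f (vpt v)|); elim/gpoint_case => [v|e t te].
  by rewrite (bigD1 v) //= addrCA lerDl addr_ge0 ?sumr_ge0.
rewrite (bigD1 e) //= -addrA ler_wpDr ?addr_ge0 ?sumr_ge0 //.
case/andP: te => t0 tL.
by rewrite (le_trans (fM e t _)) ?ler_norm ?ltW.
Qed.

Lemma continuous_measurable_gborel f : continuous f ->
  measurable_fun setT (f : gborel G -> R).
Proof.
move=> /continuousP cf.
apply: (measurability _ (measurable_realfun.RGenOInfty.measurableE R)) => //.
move=> _ [_ [x ->] <-]; rewrite setTI.
by apply: sub_sigma_algebra; apply: cf; exact: interval_open.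
Qed.

Lemma continuous_integrable (nu : {finite_measure set (gborel G) -> \bar R}) f :
  continuous f -> nu.-integrable setT (EFin \o (f : gborel G -> R)).
Proof.
move=> cf; apply: measurable_bounded_integrable => //.
- by rewrite ltey_eq fin_num_measure.
- exact: continuous_measurable_gborel.
have [M fM] := gpoint_continuous_bounded cf.
exists M; split; first exact: num_real.
by move=> N MN p _; exact: le_trans (fM p) (ltW MN).
Qed.

Lemma charge_integral_jordan : exists P N (PN : hahn_decomposition mu P N),
  forall f, charge_integral mu f =
    \int[jordan_pos PN]_t f t - \int[jordan_neg PN]_t f t.
Proof. by exists _, _, (projT2 (cid (projT2 (cid (Hahn_decomposition mu))))). Qed.

(** Both Jordan parts are finite measures, and continuous functions are bounded and Borel, so every
    integral involved is a genuine one. *)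
Lemma charge_integral_lin f g c : continuous f -> continuous g ->
  charge_integral mu (fun p => c * f p + g p) =
  c * charge_integral mu f + charge_integral mu g.
Proof.
move=> cf cg; have [P [N [PN intE]]] := charge_integral_jordan.
have lin (nu : {finite_measure set (gborel G) -> \bar R}) :
    (\int[nu]_t (c * f t + g t) = c * \int[nu]_t f t + \int[nu]_t g t)%R.
  have If := continuous_integrable nu cf; have Ig := continuous_integrable nu cg.
  rewrite (@RintegralD _ (gborel G) R nu setT (fun t => c * f t) g) //.
    by rewrite (@RintegralZl _ (gborel G) R nu setT f).
  by apply: continuous_integrable; exact: continuous_scale.
rewrite !intE !lin; ring.
Qed.

Lemma charge_integral_cst c : mu setT = 1%E -> charge_integral mu (fun=> c) = c.
Proof.
move=> mu1; have [P [N [PN ->]]] := charge_integral_jordan.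
rewrite !(@Rintegral_cst _ (gborel G)) // -mulrBr.
have := jordan_decomp PN (@measurableT _ (gborel G)); rewrite mu1 /cadd /= cscaleN1.
by move=> /(congr1 fine); rewrite fineB ?fin_num_measure // => <-; rewrite mulr1.
Qed.

Lemma green_tau_resistance x y : is_canonical_measure mu ->
  green mu x y = tau_constant mu - 2^-1 * resistance x y.
Proof.
move=> [mu1 [c muc]].
(* By definition [resistance p z] is [voltage z p p], so the defining property of the canonical
   measure states that all resistance means equal [c], which is twice the tau constant. *)
have r_mean p : charge_integral mu (resistance p) = c.
  exact: muc.
have mean_lin p (a b : R) :
    charge_integral mu (fun z => a * resistance p z + b) = a * c + b.
  rewrite charge_integral_lin ?charge_integral_cst ?r_mean //.
    exact: resistance_continuous.
  by move=> q; exact: cst_continuous.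
have v_mean p q : voltage_integral mu p q = c - 2^-1 * resistance p q.
  rewrite /voltage_integral.
  rewrite (_ : (fun z => _) = (fun z => 2^-1 * resistance p z +
      (2^-1 * resistance q z + - (2^-1 * resistance p q)))); last first.
    by apply/funext => z; rewrite voltage_resistance; ring.
  rewrite charge_integral_lin ?mean_lin ?r_mean; first by field.
    exact: resistance_continuous.
  apply: continuous_lin; first exact: resistance_continuous.
  by move=> ?; exact: cst_continuous.
rewrite /green /tau_constant v_mean.
(* The inner integral is [c] minus half a resistance; averaging over [x'] leaves [c / 2] for every
   [y']. *)
have -> : (fun y' => charge_integral mu (fun x' =>
    charge_integral mu (fun z => voltage z x' y'))) = (fun=> c / 2).
  apply/funext => q.
  rewrite (_ : (fun x' => _) = (fun x' => - 2^-1 * resistance q x' + c)).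
    by rewrite mean_lin; field.
  apply/funext => p; rewrite -/(voltage_integral mu p q) v_mean resistanceC.
  by ring.
by rewrite charge_integral_cst // v_mean resistance0; field.
Qed.

End ChargeIntegral.


(** * The three cases of the theorem *)

Lemma edge_set_ept (R : realType) (G : metrized_graph R) (e : edge G) (t : R) :
  0 <= t <= elen e -> edge_set e (ept e t).
Proof. by move=> te; exists t => //=; rewrite in_itv. Qed.

Lemma edge_set_src (R : realType) (G : metrized_graph R) (e : edge G) :
  edge_set e (vpt (src e)).
Proof.
rewrite -(ept_src e (lexx 0)); apply: edge_set_ept.
by rewrite lexx ltW ?elen_gt0.
Qed.

Lemma edge_set_tgt (R : realType) (G : metrized_graph R) (e : edge G) :
  edge_set e (vpt (tgt e)).
Proof.
rewrite -(ept_tgt (lexx (elen e))); apply: edge_set_ept.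
by rewrite lexx ltW ?elen_gt0.
Qed.

Theorem theorem4p4 (R : realType) (G : metrized_graph R)
    (mu : {charge set (gborel G) -> \bar R}) (mu_can : is_canonical_measure mu)
    (ei ej : edge G) (x y : R)
    (hx : x \in `[0, elen ei]) (hy : y \in `[0, elen ej]) :
  let tau := tau_constant mu in
  let g := green mu (ept ei x) (ept ej y) in
  let r (a b : vert G) := resistance (vpt a) (vpt b) in
  let L_i := elen ei in let L_j := elen ej in
  let p_i := src ei in let q_i := tgt ei in
  let p_j := src ej in let q_j := tgt ej in
  [/\ ei = ej -> is_bridge ei -> g = tau - 2^-1 * `|x - y|,
      is_bridge ei -> is_bridge ej -> ei <> ej ->
        [/\ between ei p_i ej p_j ->
              g = tau - 2^-1 * (x + y + r p_i p_j),
            between ei p_i ej q_j ->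
              g = tau - 2^-1 * (x + L_j - y + r p_i q_j),
            between ei q_i ej p_j ->
              g = tau - 2^-1 * (L_i - x + y + r p_j q_i)
          & between ei q_i ej q_j ->
              g = tau - 2^-1 * (L_i - x + L_j - y + r q_i q_j)]
    & is_bridge ei -> ~ is_bridge ej ->
        (component_without ei p_i (ept ej y) ->
           g = tau + y ^+ 2 * ((L_j - r p_j q_j) / (2 * L_j ^+ 2))
               - y * ((L_j - r p_j q_j + r p_i q_j - r p_i p_j) / (2 * L_j))
               - 2^-1 * (x + r p_i p_j)) /\
        (component_without ei q_i (ept ej y) ->
           g = tau + y ^+ 2 * ((L_j - r p_j q_j) / (2 * L_j ^+ 2))
               - y * ((L_j - r p_j q_j + r q_i q_j - r q_i p_j) / (2 * L_j))
               - 2^-1 * (L_i - x + r q_i p_j))].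

Proof.
move=> tau g r L_i L_j p_i q_i p_j q_j.
(* The point of [ej] is put first, so that it serves as the outside point in the formulas across the
   bridge [ei]. *)
have gE : g = tau - 2^-1 * resistance (ept ej y) (ept ei x).
  by rewrite resistanceC; exact: green_tau_resistance.
rewrite !in_itv /= in hx hy.
have y_ej := edge_set_ept hy.
have L0 : elen ej != 0 by rewrite gt_eqF ?elen_gt0.
(* Seen from a vertex, the resistance is an explicit quadratic polynomial along [ej]; this handles
   the edge that is not a bridge. *)
have quad v : resistance (vpt v) (ept ej y) = r v p_j +
    y * ((L_j - r p_j q_j + r v q_j - r v p_j) / L_j) -
    y ^+ 2 * ((L_j - r p_j q_j) / L_j ^+ 2).
  rewrite resistance_ept //.
  by rewrite /r /L_j /p_j /q_j; field; exact: L0.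
rewrite !{}gE; split.
(* On a bridge the end points are at resistance [elen], so the quadratic correction to [|x - y|]
   vanishes. *)
- move=> eij bi; rewrite {}eij in bi hx *; congr (_ - _ * _).
  rewrite resistance_same_edge // resistance_bridge // resistance0 /=.
  by rewrite /connected_without connect0 distrC; ring.
(* The segment of [ei] is split off first, as the point of [ej] lies beyond one end of [ei]; that
   end lies beyond an end of [ej], which splits off the second segment. *)
- move=> bi bj _; split=> -[/(_ _ y_ej) yi ij]; congr (_ - _ * _).
  + rewrite (resistance_bridge_src bi hx yi) resistanceC.
    by rewrite (resistance_bridge_src bj hy (ij _ (edge_set_src _))) addrA.
  + rewrite (resistance_bridge_src bi hx yi) resistanceC.
    by rewrite (resistance_bridge_tgt bj hy (ij _ (edge_set_src _))) !addrA.
  + rewrite (resistance_bridge_tgt bi hx yi) resistanceC.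
    by rewrite (resistance_bridge_src bj hy (ij _ (edge_set_tgt _))) addrA resistanceC.
  + rewrite (resistance_bridge_tgt bi hx yi) resistanceC.
    by rewrite (resistance_bridge_tgt bj hy (ij _ (edge_set_tgt _))) !addrA.
(* The bridge [ei] is split off, and [quad] evaluates the resistance from its end vertex to the
   point of [ej]. *)
- move=> bi _; split => yi.
  + rewrite (resistance_bridge_src bi hx yi) resistanceC quad /r /L_j.
    by field; exact: L0.
  + rewrite (resistance_bridge_tgt bi hx yi) resistanceC quad /r /L_j /L_i.
    by field; exact: L0.
Qed.
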